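(* There is a function $\varepsilon(n)\to 0$ as $n\to\infty$ such that for every $n$, every graph $G$ on $n$ vertices and every family of nonnegative interaction strengths $J$, the mixing time $t_{\mathrm{mix}}^+(G,J)$ of the discrete-time Glauber dynamics for the Ising model on $G$ with interactions $J$, started from the all-plus configuration, satisfies $$t_{\mathrm{mix}}^+(G,J)\ \ge\ \Big(\tfrac14-\varepsilon(n)\Big)\, n\log n .$$ Equivalently, $\inf_{G,J} t_{\mathrm{mix}}^+(G,J)\ge (1/4+o(1))\,n\log n$, the infimum over all $n$-vertex graphs $G$ and all nonnegative interaction matrices $J$.
   Context: Let $G=(V,E)$ be a finite graph with $|V|=n$ and $J=\{J_{uv}\ge 0: uv\in E\}$. The (ferromagnetic, zero-field) Ising model is the probability measure on $\Omega=\{\pm1\}^V$ given by $\mu_G(\sigma)=Z(J)^{-1}\exp\big(\sum_{uv\in E}J_{uv}\sigma(u)\sigma(v)\big)$, where $Z(J)$ is a normalizing constant. The discrete-time Glauber dynamics is the Markov chain on $\Omega$ which at each step chooses a vertex $v\in V$ uniformly at random and replaces $\sigma(v)$ by a spin drawn from the conditional distribution under $\mu_G$ given the spins at all other vertices. For a chain with stationary distribution $\pi$, the total variation distance is $\|\mu-\nu\|_{TV}=\frac12\sum_x|\mu(x)-\nu(x)|$, and the mixing time from state $x$ is $t_{\mathrm{mix}}^x=\min\{t:\|\mathbb P_x(X_t\in\cdot)-\pi\|_{TV}\le 1/4\}$. $t_{\mathrm{mix}}^+$ denotes $t_{\mathrm{mix}}^x$ for $x$ the all-plus configuration. *)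

(* Defs.v *)
From mathcomp Require Import all_boot all_order all_algebra.
From mathcomp Require Import all_classical all_reals all_analysis.
Set Implicit Arguments. Unset Strict Implicit. Unset Printing Implicit Defensive.
Import Order.TTheory GRing.Theory Num.Theory.
Local Open Scope ring_scope.

(* Ferromagnetic zero-field Ising model on a graph with vertex set 'I_n,
   edge relation e (simple graph: symmetric, irreflexive), interactions J.
   Spins: true = +1, false = -1.  Each unordered edge {i,j} is counted once
   (via i < j). *)
Section Ising.
Variables (R : realType) (n : nat) (e : rel 'I_n) (J : 'I_n -> 'I_n -> R).

Notation config := {ffun 'I_n -> bool}.

Definition spin (b : bool) : R := if b then 1 else -1.

Definition energy (s : config) : R :=
  \sum_(i : 'I_n) \sum_(j : 'I_n | (i < j)%N && e i j)
     J i j * spin (s i) * spin (s j).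

Definition weight (s : config) : R := expR (energy s).

Definition Zpart : R := \sum_(s : config) weight s.

Definition ising (s : config) : R := weight s / Zpart.

Definition setspin (s : config) (v : 'I_n) (b : bool) : config :=
  [ffun w => if w == v then b else s w].

(* Glauber transition probability P(s, t): pick v uniformly, resample s(v)
   from the conditional law of mu_G given the other spins. *)
Definition glauber (s t : config) : R :=
  n%:R^-1 * \sum_(v : 'I_n | [forall w, (w != v) ==> (t w == s w)])
     ising t / (ising (setspin s v true) + ising (setspin s v false)).

Definition allplus : config := [ffun => true].

Fixpoint law (x : config) (t : nat) : {ffun config -> R} :=
  match t with
  | 0 => [ffun y => if y == x then 1 else 0]
  | t'.+1 => [ffun y => \sum_(z : config) law x t' z * glauber z y]
  end.

Definition tv_dist (mu nu : config -> R) : R :=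
  2^-1 * \sum_(s : config) `|mu s - nu s|.

Definition dist_at (x : config) (t : nat) : R := tv_dist (law x t) ising.

Definition is_tmix (x : config) (t : nat) : Prop :=
  dist_at x t <= 4^-1 /\ forall s, (s < t)%N -> 4^-1 < dist_at x s.

End Ising.

(* Main.v *)
(* Let [S] be the magnetization, [P] the (positive semidefinite) transition
   operator, [t <= n log n / 4], and [a = n^(2/3) / 8], so that [t = o(a^2)].

   If [pi (S >= a) >= 128 t / a^2], then [S] is too slow: [k |-> <S, P^k S>]
   is convex, hence [E_pi (S_0 - S_t)^2 <= 4 t], so by Chebyshev the chain
   started from [pi] conditioned on [S >= a] still has [S_t >= a / 2] with
   probability at least 7/8.  By monotonicity so does the chain started from
   all plus, whereas [pi (S >= a / 2) <= 1/2] by spin-flip symmetry.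

   Otherwise [pi (|S| >= a)] is small.  For a fixed sequence of updated
   vertices, the chain started from all plus dominates a stationary sample in
   which the never updated vertices are reset to plus.  When [|S| < a], about
   half of the vertices are minus, and of these about [n^(2/3)] or more are
   never updated (Chebyshev again), which lifts [S] above [a]. *)

Require Import Defs.
From mathcomp Require Import all_boot all_order all_algebra.
From mathcomp Require Import all_classical all_reals all_analysis.
From mathcomp Require Import ring lra.
Import Order.TTheory GRing.Theory Num.Theory numFieldNormedType.Exports.
Local Open Scope classical_set_scope.
Local Open Scope ring_scope.

(** * Heat-bath updates as self-adjoint operators on observables *)

Section HeatBath.
Context (R : realType) (n : nat) (e : rel 'I_n) (J : 'I_n -> 'I_n -> R).
Notation config := {ffun 'I_n -> bool}.
Local Notation pi := (ising e J).

Lemma Zpart_gt0 : 0 < Zpart e J.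
Proof.
rewrite /Zpart (bigD1 (allplus n)) //= ltr_pwDl ?expR_gt0 //.
by apply: sumr_ge0 => s _; exact: expR_ge0.
Qed.

Lemma ising_gt0 s : 0 < pi s.
Proof. by rewrite divr_gt0 ?expR_gt0 ?Zpart_gt0. Qed.

Lemma ising_ge0 s : 0 <= pi s.
Proof. exact/ltW/ising_gt0. Qed.

Lemma sum_ising : \sum_s pi s = 1.
Proof. by rewrite -mulr_suml mulfV // gt_eqF ?Zpart_gt0. Qed.

Definition mean (f : config -> R) : R := \sum_s pi s * f s.

(** Conditional expectation of [f] under the Ising measure given the spins off [v]. *)
Definition upd (v : 'I_n) (f : config -> R) (s : config) : R :=
  let sp := setspin s v true in let sm := setspin s v false in
  (pi sp * f sp + pi sm * f sm) / (pi sp + pi sm).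

Definition step (f : config -> R) (s : config) : R :=
  n%:R^-1 * \sum_v upd v f s.

Lemma updD_gt0 s v : 0 < pi (setspin s v true) + pi (setspin s v false).
Proof. by rewrite addr_gt0 ?ising_gt0. Qed.

Lemma setspin_id (s : config) v : setspin s v (s v) = s.
Proof. by apply/ffunP => w; rewrite ffunE; case: eqP => // ->. Qed.

Lemma setspin2 (s : config) v b c : setspin (setspin s v b) v c = setspin s v c.
Proof. by apply/ffunP => w; rewrite !ffunE; case: eqP. Qed.

Lemma setspin_agree (s y : config) v :
  (forall w, w != v -> y w = s w) -> y = setspin s v (y v).
Proof.
move=> h; apply/ffunP => w; rewrite ffunE.
by have [->//|wv] := eqVneq w v; exact: h.
Qed.

Lemma setspin_neq (s : config) v : setspin s v false != setspin s v true.
Proof.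
by apply/eqP => /(congr1 (fun y : config => y v)); rewrite !ffunE eqxx.
Qed.

Lemma glauberE s f : \sum_y glauber e J s y * f y = step f s.
Proof.
rewrite /step /glauber.
under eq_bigr do rewrite -mulrA mulr_suml.
rewrite -mulr_sumr; congr (_ * _).
rewrite (exchange_big_dep xpredT) //=; apply: eq_bigr => v _.
under eq_bigr do rewrite mulrAC.
rewrite -mulr_suml; congr (_ / _).
have agree (y : config) : [forall w, (w != v) ==> (y w == s w)] =
    (y == setspin s v true) || (y == setspin s v false).
  apply/forallP/orP => [h|[]/eqP -> w]; last 2 first.
  - by rewrite ffunE; case: (w == v) => /=.
  - by rewrite ffunE; case: (w == v) => /=.
  have -> : y = setspin s v (y v).
    by apply: setspin_agree => w wv; have /implyP/(_ wv)/eqP := h w.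
  by case: (y v); [left|right].
rewrite (eq_bigl _ _ agree) (bigD1 (setspin s v true)) ?eqxx //=.
rewrite (bigD1 (setspin s v false)) ?eqxx ?orbT ?setspin_neq //=.
rewrite big1 ?addr0 // => y /andP[/andP[/orP[/eqP->|/eqP->]]];
  by rewrite eqxx ?andbF.
Qed.

(** Duality: [iter t step f x] is the expectation of [f] at time [t] from [x], so the rest works
    with observables only. *)
Lemma lawE x t f : \sum_y law e J x t y * f y = iter t step f x.
Proof.
elim: t f => [|t IHt] f.
  rewrite (bigD1 x) //= ffunE eqxx mul1r big1 ?addr0 // => y /negPf yx.
  by rewrite ffunE yx mul0r.
rewrite iterSr -IHt /=.
under eq_bigr do rewrite ffunE mulr_suml.
rewrite exchange_big /=; apply: eq_bigr => z _.
by rewrite -glauberE mulr_sumr; apply: eq_bigr => y _; rewrite mulrA.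
Qed.

(** Flipping [v] is an involution pairing the two values of [setspin s v], so every configuration is
    counted twice. *)
Lemma sum_setspin (h : config -> R) v :
  \sum_s (h (setspin s v true) + h (setspin s v false)) = 2 * \sum_s h s.
Proof.
pose flip s := setspin s v (~~ s v).
have flipK : involutive flip.
  by move=> s; rewrite /flip setspin2 ffunE eqxx negbK setspin_id.
rewrite mulrDl !mul1r [X in _ = _ + X](reindex_inj (inv_inj flipK)) /=.
rewrite -big_split; apply: eq_bigr => s _ /=; rewrite /flip.
by have := setspin_id s v; case: (s v) => /= {3}<-; rewrite // addrC.
Qed.

Lemma upd_setspin v f s b : upd v f (setspin s v b) = upd v f s.
Proof. by rewrite /upd /= !setspin2. Qed.

Lemma mean_upd v f g : 2 * mean (fun s => f s * upd v g s) =
  \sum_s (pi (setspin s v true) * f (setspin s v true)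
          + pi (setspin s v false) * f (setspin s v false)) * upd v g s.
Proof.
rewrite /mean -(sum_setspin (fun s => pi s * (f s * upd v g s)) v).
by apply: eq_bigr => s _; rewrite !upd_setspin mulrDl !mulrA.
Qed.

(** By [mean_upd], each side sums the product of the unnormalized pair averages of [f] and [g]
    divided by the mass of the pair, which is symmetric in [f] and [g]. *)
Lemma upd_sym v f g :
  mean (fun s => f s * upd v g s) = mean (fun s => upd v f s * g s).
Proof.
apply: (@mulfI _ 2); first by rewrite pnatr_eq0.
have -> : (fun s => upd v f s * g s) = (fun s => g s * upd v f s).
  by apply/funext => s; rewrite mulrC.
by rewrite !mean_upd; apply: eq_bigr => s _; rewrite /upd /= mulrCA mulrA.
Qed.

Lemma upd_psd v f : 0 <= mean (fun s => f s * upd v f s).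
Proof.
rewrite -(pmulr_rge0 _ (ltr0n R 2)) mean_upd; apply: sumr_ge0 => s _.
by rewrite /upd /= mulrA -expr2 divr_ge0 ?sqr_ge0 // ltW ?updD_gt0.
Qed.

Lemma upd_cst v c s : upd v (fun=> c) s = c.
Proof. by rewrite /upd /= -mulrDl mulrAC mulfV ?mul1r // gt_eqF ?updD_gt0. Qed.

(** Stationarity is self-adjointness tested against the constant 1. *)
Lemma mean_upd1 v f : mean (upd v f) = mean f.
Proof.
have := upd_sym v (fun=> 1) f; rewrite /mean.
under eq_bigr do rewrite mul1r.
by move=> ->; apply: eq_bigr => s _; rewrite upd_cst mul1r.
Qed.

Lemma eq_upd v f g s :
  (forall b, f (setspin s v b) = g (setspin s v b)) -> upd v f s = upd v g s.
Proof. by move=> fg; rewrite /upd !fg. Qed.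

Lemma updD v f g s : upd v (fun s => f s + g s) s = upd v f s + upd v g s.
Proof. rewrite /upd /=; ring. Qed.

Lemma updZ v c f s : upd v (fun s => c * f s) s = c * upd v f s.
Proof. rewrite /upd /=; ring. Qed.

Lemma ler_upd v f g s : (forall s, f s <= g s) -> upd v f s <= upd v g s.
Proof.
move=> fg; rewrite /upd /= ler_pM2r ?invr_gt0 ?updD_gt0 //.
by rewrite lerD // ler_wpM2l ?ising_ge0.
Qed.

Lemma mean_sum (I : Type) (r : seq I) (F : I -> config -> R) :
  mean (fun s => \sum_(i <- r) F i s) = \sum_(i <- r) mean (F i).
Proof.
by rewrite /mean; under eq_bigr do rewrite mulr_sumr; rewrite exchange_big.
Qed.

Lemma meanD f g : mean (fun s => f s + g s) = mean f + mean g.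
Proof. by rewrite /mean -big_split; apply: eq_bigr => s _; rewrite mulrDr. Qed.

Lemma meanZ c f : mean (fun s => c * f s) = c * mean f.
Proof. by rewrite /mean mulr_sumr; apply: eq_bigr => s _; rewrite mulrCA. Qed.

Lemma meanN f : mean (fun s => - f s) = - mean f.
Proof. by rewrite /mean -sumrN; apply: eq_bigr => s _; rewrite mulrN. Qed.

Lemma mean_cst c : mean (fun=> c) = c.
Proof. by rewrite /mean -mulr_suml sum_ising mul1r. Qed.

Lemma ler_mean f g : (forall s, f s <= g s) -> mean f <= mean g.
Proof. by move=> fg; apply: ler_sum => s _; rewrite ler_wpM2l ?ising_ge0. Qed.

Lemma eq_mean f g : f =1 g -> mean f = mean g.
Proof. by move=> fg; apply: eq_bigr => s _; rewrite fg. Qed.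

Lemma step_sym f g :
  mean (fun s => f s * step g s) = mean (fun s => step f s * g s).
Proof.
transitivity (n%:R^-1 * \sum_v mean (fun s => f s * upd v g s)).
  rewrite -mean_sum -meanZ; apply: eq_mean => s.
  by rewrite -mulr_sumr mulrCA.
rewrite (eq_bigr _ (fun v _ => upd_sym v f g)) -mean_sum -meanZ.
by apply: eq_mean => s; rewrite -mulr_suml mulrA.
Qed.

Lemma step_psd f : 0 <= mean (fun s => f s * step f s).
Proof.
have -> : mean (fun s => f s * step f s)
    = n%:R^-1 * \sum_v mean (fun s => f s * upd v f s).
  rewrite -mean_sum -meanZ; apply: eq_mean => s.
  by rewrite -mulr_sumr mulrCA.
by rewrite mulr_ge0 ?invr_ge0 ?ler0n // sumr_ge0 // => v _; exact: upd_psd.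
Qed.

Lemma stepD f g s : step (fun s => f s + g s) s = step f s + step g s.
Proof.
rewrite /step -mulrDr -big_split /=; congr (_ * _).
by apply: eq_bigr => v _; rewrite updD.
Qed.

Lemma stepZ c f s : step (fun s => c * f s) s = c * step f s.
Proof.
rewrite /step mulrCA [c * _]mulr_sumr; congr (_ * _).
by apply: eq_bigr => v _; rewrite updZ.
Qed.

Lemma ler_step f g s : (forall s, f s <= g s) -> step f s <= step g s.
Proof.
move=> fg; rewrite ler_wpM2l ?invr_ge0 ?ler0n //.
by apply: ler_sum => v _; exact: ler_upd.
Qed.

Lemma iter_stepD t f g s :
  iter t step (fun s => f s + g s) s = iter t step f s + iter t step g s.
Proof.
elim: t s => //= t IHt s; rewrite -stepD; apply: (congr1 (step^~ s)).
exact/funext.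
Qed.

Lemma iter_stepZ t c f s :
  iter t step (fun s => c * f s) s = c * iter t step f s.
Proof.
elim: t s => //= t IHt s; rewrite -stepZ; apply: (congr1 (step^~ s)).
exact/funext.
Qed.

Lemma ler_iter_step t f g s :
  (forall s, f s <= g s) -> iter t step f s <= iter t step g s.
Proof. by move=> fg; elim: t s => //= t IHt s; exact: ler_step. Qed.

(** Induction by two: self-adjointness moves one factor of [step] to the left, so the pair [k.+2],
    [f] reduces to [k], [step f]. *)
Lemma iter_step_psd k f : 0 <= mean (fun s => f s * iter k step f s).
Proof.
elim/ltn_ind: k f => -[|[|k]] IHk f.
- rewrite /= -(mean_cst 0); apply: ler_mean => s; exact: sqr_ge0.
- exact: step_psd.
rewrite iterS iterSr step_sym; exact: IHk.
Qed.

Hypothesis n_gt0 : (0 < n)%N.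

Lemma nR_gt0 : 0 < n%:R :> R. Proof. by rewrite ltr0n. Qed.

Lemma step_cst c s : step (fun=> c) s = c.
Proof.
rewrite /step (eq_bigr _ (fun v _ => upd_cst v c s)) sumr_const card_ord.
by rewrite -[c *+ n]mulr_natl mulKf // gt_eqF ?nR_gt0.
Qed.

Lemma iter_step_cst t c s : iter t step (fun=> c) s = c.
Proof.
elim: t s => //= t IHt s; rewrite -[RHS](step_cst c s).
apply: (congr1 (step^~ s)).
exact/funext.
Qed.

Lemma mean_step f : mean (step f) = mean f.
Proof.
rewrite /step meanZ mean_sum (eq_bigr _ (fun v _ => mean_upd1 v f)).
by rewrite sumr_const card_ord -[mean f *+ n]mulr_natl mulKf // gt_eqF ?nR_gt0.
Qed.

Lemma mean_iter_step t f : mean (iter t step f) = mean f.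
Proof. by elim: t => //= t IHt; rewrite mean_step. Qed.

(** * Stationary autocorrelations and mean square displacement *)

Definition autocor (f : config -> R) (k : nat) : R :=
  mean (fun s => f s * iter k step f s).

(** Expand the square; by stationarity both square terms have mean [autocor f 0]. *)
Lemma mean_sqr_diff t f :
  mean (fun s => iter t step (fun y => (f s - f y) ^+ 2) s)
  = 2 * (autocor f 0 - autocor f t).
Proof.
rewrite /autocor /=.
have -> : (fun s => iter t step (fun y => (f s - f y) ^+ 2) s) =
    (fun s => f s * f s + (-2 * (f s * iter t step f s)
       + iter t step (fun y => f y * f y) s)).
  apply/funext => s.
  have -> : (fun y => (f s - f y) ^+ 2) =
      (fun y => f s * f s + (-2 * f s * f y + f y * f y)).
    by apply/funext => y; ring.
  by rewrite !iter_stepD iter_step_cst iter_stepZ mulrA.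
rewrite !meanD meanZ mean_iter_step; ring.
Qed.

(* [k |-> <f, P^k f>] is convex because [P] is positive semidefinite. *)
Lemma autocor_convex f k :
  autocor f k.+1 - autocor f k.+2 <= autocor f k - autocor f k.+1.
Proof.
have := iter_step_psd k (fun s => f s + -1 * step f s).
have -> : (fun s => (f s + -1 * step f s)
      * iter k step (fun s => f s + -1 * step f s) s) =
    (fun s => (f s * iter k step f s + - (f s * iter k.+1 step f s))
      + (- (step f s * iter k step f s) + step f s * iter k.+1 step f s)).
  by apply/funext => s; rewrite iter_stepD iter_stepZ -iterSr; ring.
rewrite !meanD !meanN -!step_sym /autocor !iterS /=; lra.
Qed.

(** By convexity the first decrement is the largest; telescope. *)
Lemma autocor_drop f t :
  autocor f 0 - autocor f t <= t%:R * (autocor f 0 - autocor f 1).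
Proof.
have drop k : autocor f k - autocor f k.+1 <= autocor f 0 - autocor f 1.
  by elim: k => // k; apply: le_trans; exact: autocor_convex.
elim: t => [|t IHt]; first by rewrite subrr mul0r.
by have := drop t; rewrite -natr1 mulrDl mul1r; lra.
Qed.

(** A single step displaces [f] by at most [c] in mean square, and [autocor_drop] makes the growth
    in [t] linear rather than quadratic. *)
Lemma mean_sqr_diff_le t f c :
  (forall v s, upd v (fun y => (f s - f y) ^+ 2) s <= c) ->
  mean (fun s => iter t step (fun y => (f s - f y) ^+ 2) s) <= t%:R * c.
Proof.
move=> fc; rewrite mean_sqr_diff.
have := mean_sqr_diff 1 f => /= e1.
have : mean (fun s => step (fun y => (f s - f y) ^+ 2) s) <= c.
  rewrite -[leRHS]mean_cst; apply: ler_mean => s.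
  rewrite /step -[leRHS](mulKf (lt0r_neq0 nR_gt0)).
  rewrite ler_pM2l ?invr_gt0 ?nR_gt0 //.
  rewrite mulr_natl -[n in leRHS]card_ord -sumr_const.
  by apply: ler_sum => v _; exact: fc.
rewrite e1 => h; apply: le_trans (ler_wpM2l (ler0n _ _) h).
by have := autocor_drop f t; lra.
Qed.

End HeatBath.

(** * Uniformly random update sequences and their unvisited vertices *)

Section Words.
Context (R : realType) (n : nat).
Hypothesis n_gt0 : (0 < n)%N.

(** Expectation over [t] independent uniform vertices; the head of the word is the first update in
    time. *)
Fixpoint avg (t : nat) (F : seq 'I_n -> R) : R :=
  if t is t'.+1 then n%:R^-1 * \sum_v avg t' (fun w => F (v :: w))
  else F [::].

Lemma avgD t F G : avg t (fun w => F w + G w) = avg t F + avg t G.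
Proof.
elim: t F G => //= t IHt F G; rewrite -mulrDr -big_split /=.
by congr (_ * _); apply: eq_bigr => v _; rewrite IHt.
Qed.

Lemma avgZ t c F : avg t (fun w => c * F w) = c * avg t F.
Proof.
elim: t F => //= t IHt F; rewrite [RHS]mulrCA [c * _]mulr_sumr.
by congr (_ * _); apply: eq_bigr => v _; rewrite IHt.
Qed.

(** The shape of [upd], so that [avg] commutes with a single-site update. *)
Lemma avg_lin t c d k F G :
  avg t (fun w => (c * F w + d * G w) / k) = (c * avg t F + d * avg t G) / k.
Proof.
rewrite -!avgZ -avgD mulrC -avgZ; congr avg.
by apply/funext => w; rewrite mulrC.
Qed.

Lemma avg_cst t c : avg t (fun=> c) = c.
Proof.
elim: t => //= t ->; rewrite sumr_const card_ord -[c *+ n]mulr_natl mulKf //.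
by rewrite pnatr_eq0 -lt0n.
Qed.

Lemma eq_avg t F G : F =1 G -> avg t F = avg t G.
Proof. by move=> /funext ->. Qed.

Lemma ler_avg t F G : (forall w, F w <= G w) -> avg t F <= avg t G.
Proof.
elim: t F G => //= t IHt F G FG; rewrite ler_wpM2l ?invr_ge0 ?ler0n //.
by apply: ler_sum => v _; exact: IHt.
Qed.

Lemma avg_sum t (I : Type) (r : seq I) (P : pred I) (F : I -> seq 'I_n -> R) :
  avg t (fun w => \sum_(i <- r | P i) F i w) = \sum_(i <- r | P i) avg t (F i).
Proof.
elim: r => [|i r IHr].
  by rewrite big_nil -[RHS](avg_cst t); apply: eq_avg => w; rewrite big_nil.
rewrite big_cons -IHr; case: ifP => Pi.
  by rewrite -avgD; apply: eq_avg => w; rewrite big_cons Pi.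
by apply: eq_avg => w; rewrite big_cons Pi.
Qed.

Lemma avg_avoid t (A : {set 'I_n}) :
  avg t (fun w => (all (fun x => x \notin A) w)%:R)
  = ((n - #|A|)%:R / n%:R) ^+ t.
Proof.
elim: t => //= t IHt.
under eq_bigr => v _.
  rewrite (eq_avg _ _ (fun w => (v \notin A)%:R
      * (all (fun x => x \notin A) w)%:R)); last first.
    by move=> w; rewrite -natrM mulnb.
  rewrite avgZ IHt; over.
rewrite -mulr_suml mulrA exprS; congr (_ * _); rewrite mulrC; congr (_ / _).
have -> : (n - #|A| = #|~: A|)%N.
  by rewrite [in RHS]cardsCs finset.setCK card_ord.
rewrite -natr_sum -sum1_card [in RHS]big_mkcond /=.
by congr (_%:R); apply: eq_bigr => v _; rewrite inE; case: (v \in A).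
Qed.

Lemma avg_unvisited t v :
  avg t (fun w => (v \notin w)%:R) = ((n - 1)%:R / n%:R) ^+ t.
Proof.
rewrite -(cards1 v) -avg_avoid; apply: eq_avg => w.
congr (_%:R); congr nat_of_bool; elim: w => //= x w <-.
by rewrite !inE negb_or eq_sym.
Qed.

(** For distinct vertices the events are negatively correlated, since 1 - 2/n <= (1 - 1/n)^2; the
    first summand pays for the diagonal. *)
Lemma avg_unvisited2 t u v :
  avg t (fun w => (u \notin w)%:R * (v \notin w)%:R)
  <= (u == v)%:R * ((n - 1)%:R / n%:R) ^+ t + ((n - 1)%:R / n%:R) ^+ t ^+ 2.
Proof.
have [->|uv] := eqVneq u v.
  rewrite mul1r -[leLHS]addr0 lerD ?sqr_ge0 // -(avg_unvisited t v).
  by apply: ler_avg => w; case: (v \notin w); rewrite /= ?mul1r ?mul0r.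
rewrite mul0r add0r.
have -> : (fun w => (u \notin w)%:R * (v \notin w)%:R)
    = (fun w => (all (fun x => x \notin [set u; v]%SET) w)%:R) :> (_ -> R).
  apply/funext => w; rewrite -natrM mulnb.
  congr (_%:R); congr nat_of_bool; elim: w => //= x w <-.
  by rewrite !inE !negb_or ![x == _]eq_sym andbACA.
(* Needed for the truncated subtraction [n - 2] to be the true one. *)
have n2 : (2 <= n)%N.
  by have := max_card [set u; v]%SET; rewrite cards2 uv card_ord.
rewrite avg_avoid cards2 uv -exprM mulnC exprM.
apply: lerXn2r; rewrite ?nnegrE ?exprn_ge0 ?divr_ge0 ?ler0n //.
rewrite expr_div_n expr2 [n%:R ^+ 2]expr2 ler_pdivrMr ?ltr0n //.
rewrite [leRHS]mulrAC ler_pdivlMr ?mulr_gt0 ?ltr0n //.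
rewrite !natrB // ?(ltnW n2) //.
have : 0 < n%:R :> R by rewrite ltr0n.
rewrite /=; nra.
Qed.

(** Here [c] is the expected number of unvisited vertices of [M]; negative correlation bounds its
    second moment by [c + c ^+ 2]. *)
Lemma avg_unvisited_var t (M : {set 'I_n}) (c : R) :
  c = #|M|%:R * ((n - 1)%:R / n%:R) ^+ t ->
  avg t (fun w => (\sum_(v in M) (v \notin w)%:R - c) ^+ 2) <= c.
Proof.
move=> cE.
have -> : (fun w : seq 'I_n => (\sum_(v in M) (v \notin w)%:R - c) ^+ 2) =
    (fun w => \sum_(u in M) \sum_(v in M) (u \notin w)%:R * (v \notin w)%:R
       + (-2 * c * (\sum_(v in M) (v \notin w)%:R) + c ^+ 2)).
  apply/funext => w; rewrite -[X in _ = X + _]big_distrlr /=; ring.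
rewrite !avgD avgZ avg_cst !avg_sum.
rewrite (eq_bigr _ (fun v _ => avg_unvisited t v)) sumr_const.
rewrite -[_ *+ #|M|]mulr_natl -cE.
suff : \sum_(u in M) avg t
    (fun w => \sum_(v in M) (u \notin w)%:R * (v \notin w)%:R) <= c + c ^+ 2.
  lra.
under eq_bigr do rewrite avg_sum.
apply: (@le_trans _ _ (\sum_(u in M) (((n - 1)%:R / n%:R) ^+ t
    + #|M|%:R * ((n - 1)%:R / n%:R) ^+ t ^+ 2))).
  apply: ler_sum => u uM.
  apply: le_trans (ler_sum _ (fun v _ => avg_unvisited2 t u v)) _.
  rewrite big_split /= sumr_const -[X in _ + X]mulr_natl lerD2r.
  rewrite (bigD1 u) //= eqxx mul1r big1 ?addr0 // => v /andP[_ /negPf].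
  by rewrite eq_sym => ->; rewrite mul0r.
rewrite sumr_const -[_ *+ #|M|]mulr_natl mulrDr.
by rewrite mulrA -expr2 -exprMn -cE.
Qed.

(** Chebyshev's inequality for a deviation of half the mean. *)
Lemma avg_unvisited_ge t (M : {set 'I_n}) (c : R) :
  c = #|M|%:R * ((n - 1)%:R / n%:R) ^+ t -> 0 < c ->
  1 - 4 / c <= avg t (fun w => (c / 2 <= \sum_(v in M) (v \notin w)%:R)%R%:R).
Proof.
move=> cE c_gt0; have var := avg_unvisited_var t M c cE.
pose N (w : seq 'I_n) : R := \sum_(v in M) (v \notin w)%:R.
have : avg t (fun w => 1 + -1 * (c / 2 <= N w)%R%:R)
    <= avg t (fun w => 4 / c ^+ 2 * (N w - c) ^+ 2).
  apply: ler_avg => w; case: (leP (c / 2) (N w)) => h /=.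
    by rewrite mulN1r subrr mulr_ge0 ?sqr_ge0 // divr_ge0 // sqr_ge0.
  rewrite mulr0 addr0 mulrAC ler_pdivlMr ?exprn_gt0 // mul1r; nra.
rewrite avgD !avgZ avg_cst -/(N _) => h.
have : 4 / c ^+ 2 * avg t (fun w => (N w - c) ^+ 2) <= 4 / c.
  have -> : 4 / c = 4 / c ^+ 2 * c by field; rewrite gt_eqF.
  by rewrite ler_wpM2l // divr_ge0 // sqr_ge0.
move: h; set u := 4 / c ^+ 2 * _; set z := avg t _; set q := 4 / c; lra.
Qed.

End Words.

(** * Monotonicity of the ferromagnetic dynamics *)

Section Ferromagnet.
Context (R : realType) (n : nat) (e : rel 'I_n) (J : 'I_n -> 'I_n -> R).
Hypotheses (n_gt0 : (0 < n)%N) (J_ge0 : forall i j, 0 <= J i j).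
Notation config := {ffun 'I_n -> bool}.
Local Notation pi := (ising e J).
Local Notation mean := (mean R n e J).
Local Notation upd := (upd R n e J).
Local Notation step := (step R n e J).

Definition cle (x y : config) := forall v, x v -> y v.

Definition increasing (f : config -> R) := forall x y, cle x y -> f x <= f y.

Lemma ler_spin (b c : bool) : (b -> c) -> spin R b <= spin R c.
Proof. by rewrite /spin; case: b => [/(_ isT) ->//|_]; case: c; lra. Qed.

Lemma setspin_cle x y v (b c : bool) : cle x y -> (b -> c) ->
  cle (setspin x v b) (setspin y v c).
Proof. by move=> xy bc w; rewrite !ffunE; case: eqP => // _; exact: xy. Qed.

(** Only edges at [v] matter: each contributes its nonnegative coupling times the increase of the
    neighbouring spin from [x] to [y]. *)
Lemma energy_supermodular v x y : cle x y ->
  energy e J (setspin x v true) + energy e J (setspin y v false)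
  <= energy e J (setspin y v true) + energy e J (setspin x v false).
Proof.
move=> xy; rewrite /energy -!big_split /=; apply: ler_sum => i _.
rewrite -!big_split /=; apply: ler_sum => j /andP[ij _]; rewrite !ffunE.
have := J_ge0 i j; set c := J i j => c0.
have xyi := ler_spin _ _ (xy i); have xyj := ler_spin _ _ (xy j).
have [iv|_] := eqVneq i v; have [jv|_] := eqVneq j v.
- by move: ij; rewrite iv jv ltnn.
- by rewrite /(spin R true) /(spin R false); nra.
- by rewrite /(spin R true) /(spin R false); nra.
- by rewrite addrC.
Qed.

(** Cross-multiplied form of the fact that the conditional probability of plus at [v] increases with
    the other spins. *)
Lemma ising_ratio v x y : cle x y ->
  pi (setspin x v true) * pi (setspin y v false)
  <= pi (setspin y v true) * pi (setspin x v false).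
Proof.
move=> xy; rewrite /ising mulrACA [leRHS]mulrACA.
rewrite ler_wpM2r -?expr2 ?sqr_ge0 //.
by rewrite /weight -!expRD ler_expR; exact: energy_supermodular.
Qed.

Lemma upd_increasing v f : increasing f -> increasing (upd v f).
Proof.
move=> fi x y xy; rewrite /upd.
have := ising_ratio v x y xy.
have fp := fi _ _ (setspin_cle x y v true true xy id).
have fm := fi _ _ (setspin_cle x y v false false xy id).
have fy : f (setspin y v false) <= f (setspin y v true).
  by apply: fi; exact: setspin_cle.
have := updD_gt0 R n e J x v; have := updD_gt0 R n e J y v.
move: (ising_ge0 R n e J (setspin x v true)).
move: (ising_ge0 R n e J (setspin x v false)).
move: fp fm fy.
set a := pi (setspin x v true); set b := pi (setspin x v false).
set c := pi (setspin y v true); set d := pi (setspin y v false).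
set f1 := f _; set g1 := f _; set f2 := f _; set g2 := f _.
move=> fp fm fy b0 a0 cd ab adcb.
rewrite ler_pdivrMr // [leRHS]mulrAC ler_pdivlMr //.
(* First raise the values of [f] from [x] to [y], keeping the weights of [x]; then change the
   weights, which favours the larger value [g1]. *)
apply: (@le_trans _ _ ((a * g1 + b * g2) * (c + d))).
  by rewrite ler_pM2r // lerD // ler_wpM2l.
rewrite -subr_ge0.
have -> : (c * g1 + d * g2) * (a + b) - (a * g1 + b * g2) * (c + d)
  = (c * b - a * d) * (g1 - g2) by ring.
by rewrite mulr_ge0 // subr_ge0.
Qed.

Lemma foldr_upd_increasing w f : increasing f -> increasing (foldr upd f w).
Proof. by move=> fi; elim: w => //= v w IHw; exact: upd_increasing. Qed.

Lemma step_increasing f : increasing f -> increasing (step f).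
Proof.
move=> fi x y xy; rewrite /step ler_wpM2l ?invr_ge0 ?ler0n //.
by apply: ler_sum => v _; exact: upd_increasing.
Qed.

Lemma iter_step_increasing t f : increasing f -> increasing (iter t step f).
Proof. by move=> fi; elim: t => //= t IHt; exact: step_increasing. Qed.

Lemma cle_allplus x : cle x (allplus n).
Proof. by move=> v; rewrite ffunE. Qed.

Lemma iter_step_avg t f s :
  iter t step f s = avg R n t (fun w => foldr upd f w s).
Proof.
elim: t s => //= t IHt s; rewrite {1}/step; congr (_ * _).
by apply: eq_bigr => v _; rewrite /upd !IHt -avg_lin.
Qed.

Lemma mean_foldr_upd w f : mean (foldr upd f w) = mean f.
Proof. by elim: w => //= v w IHw; rewrite mean_upd1. Qed.

Lemma mean_avg t (F : config -> seq 'I_n -> R) :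
  mean (fun s => avg R n t (F s)) = avg R n t (fun w => mean (fun s => F s w)).
Proof. by rewrite /mean avg_sum //; apply: eq_bigr => s _; rewrite avgZ. Qed.

Definition pin (U : pred 'I_n) (y : config) : config := [ffun v => U v || y v].

(** Vertices of [U] start plus and are never updated, so they are plus at the end and pinning them
    changes nothing. *)
Lemma foldr_upd_pin (U : pred 'I_n) f w (x : config) :
  (forall v, v \in w -> ~~ U v) -> (forall v, U v -> x v) ->
  foldr upd f w x = foldr upd (fun y => f (pin U y)) w x.
Proof.
elim: w x => [|v w IHw] x wU Ux /=.
  congr (f _); apply/ffunP => v; rewrite ffunE.
  by case: (boolP (U v)) => // /Ux ->.
have vU : ~~ U v by apply: wU; rewrite mem_head.
have Uset b u : U u -> setspin x v b u.
  by rewrite ffunE; case: eqP => [->|_ /Ux//]; rewrite (negPf vU).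
have wU' u : u \in w -> ~~ U u by move=> uw; apply: wU; rewrite inE uw orbT.
by apply: eq_upd => b; apply: IHw => // u; exact: Uset.
Qed.

(* Started from all plus, the vertices not visited by [w] stay plus; the
   updates applied to a stationary start leave [pi] invariant. *)
Lemma foldr_upd_allplus_ge w f : increasing f ->
  mean (fun y => f (pin (fun v => v \notin w) y)) <= foldr upd f w (allplus n).
Proof.
move=> fi; rewrite (foldr_upd_pin (fun v => v \notin w)); last 2 first.
- by move=> v; rewrite negbK.
- by move=> v _; rewrite ffunE.
rewrite -(mean_foldr_upd w) -[leRHS](mean_cst R n e J); apply: ler_mean => s.
apply: foldr_upd_increasing; last exact: cle_allplus.
move=> x y xy; apply: fi => v; rewrite !ffunE.
by case/orP => [->//|/xy ->]; rewrite orbT.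
Qed.

(** Average over the word. Exchanging [mean] and [avg] leaves, for each fixed [y], a question about
    the random unvisited set alone. *)
Lemma iter_step_allplus_ge t f : increasing f ->
  mean (fun y => avg R n t (fun w => f (pin (fun v => v \notin w) y)))
  <= iter t step f (allplus n).
Proof.
move=> fi; rewrite mean_avg iter_step_avg; apply: ler_avg => w.
exact: foldr_upd_allplus_ge.
Qed.

(** * Magnetization and spin-flip symmetry *)

Definition mag (s : config) : R := \sum_v spin R (s v).

Definition minus (s : config) : {set 'I_n} := [set v | ~~ s v]%SET.

Lemma magE s : mag s = n%:R - 2 * #|minus s|%:R.
Proof.
have -> : #|minus s|%:R = \sum_v (~~ s v)%:R :> R.
  rewrite -natr_sum -sum1_card big_mkcond /=; congr (_%:R).
  by apply: eq_bigr => v _; rewrite inE; case: (s v).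
rewrite -[in n%:R](card_ord n) -sumr_const mulr_sumr -sumrB.
by apply: eq_bigr => v _; rewrite /spin; case: (s v) => /=; lra.
Qed.

Lemma mag_pin U s : mag (pin U s) = mag s + 2 * \sum_(v in minus s) (U v)%:R.
Proof.
rewrite /mag [in RHS](big_mkcond (mem (minus s))) mulr_sumr -big_split /=.
apply: eq_bigr => v _; rewrite ffunE inE /spin.
by case: (U v); case: (s v) => /=; lra.
Qed.

Lemma mag_increasing : increasing mag.
Proof. by move=> x y xy; apply: ler_sum => v _; exact/ler_spin/xy. Qed.

Lemma mag_allplus : mag (allplus n) = n%:R.
Proof.
rewrite /mag; under eq_bigr do rewrite ffunE.
by rewrite sumr_const card_ord.
Qed.

Definition neg (s : config) : config := [ffun v => ~~ s v].

Lemma negI : involutive neg.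
Proof. by move=> s; apply/ffunP => v; rewrite !ffunE negbK. Qed.

Lemma spinN b : spin R (~~ b) = - spin R b.
Proof. by rewrite /spin; case: b => //=; rewrite opprK. Qed.

Lemma mag_neg s : mag (neg s) = - mag s.
Proof. by rewrite /mag -sumrN; apply: eq_bigr => v _; rewrite ffunE spinN. Qed.

Lemma ising_neg s : pi (neg s) = pi s.
Proof.
congr (expR _ / _); apply: eq_bigr => i _; apply: eq_bigr => j _.
by rewrite !ffunE !spinN !mulrN mulNr opprK.
Qed.

Lemma mean_neg f : mean (fun s => f (neg s)) = mean f.
Proof.
rewrite /mean [RHS](reindex_inj (inv_inj negI)) /=.
by apply: eq_bigr => s _; rewrite ising_neg.
Qed.

(** * Magnetization tails and lower bounds on the distance to stationarity *)

Definition mag_ge (a : R) (s : config) : R := ((a <= mag s)%R)%:R.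

Lemma mag_ge_increasing a : increasing (mag_ge a).
Proof.
move=> x y xy; rewrite /mag_ge ler_nat.
case: (leP a (mag x)) => //= ax.
by rewrite (le_trans ax (mag_increasing _ _ xy)).
Qed.

(** Both measures have mass 1, so [f] may be centred at 1/2; then its absolute value is at most the
    factor 1/2 in [tv_dist]. *)
Lemma tv_ge t x f : (forall s, 0 <= f s <= 1) ->
  iter t step f x - mean f <= dist_at e J x t.
Proof.
move=> f01; rewrite -lawE /dist_at /tv_dist.
have law1 : \sum_y law e J x t y = 1.
  rewrite -(iter_step_cst R n e J n_gt0 t 1 x) -lawE.
  by apply: eq_bigr => y _; rewrite mulr1.
have -> : \sum_y law e J x t y * f y - mean f =
    \sum_y (law e J x t y - pi y) * (f y - 2^-1).
  under [RHS]eq_bigr do rewrite mulrBr.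
  rewrite sumrB -mulr_suml sumrB law1 sum_ising subrr mul0r subr0 /mean -sumrB.
  by apply: eq_bigr => y _; rewrite mulrBl.
rewrite mulr_sumr; apply: ler_sum => y _.
apply: le_trans (ler_norm _) _; rewrite normrM mulrC ler_wpM2r //.
by rewrite ler_norml; have /andP[] := f01 y; lra.
Qed.

Lemma mag_ge01 a s : 0 <= mag_ge a s <= 1.
Proof. by rewrite /mag_ge ler0n lern1 leq_b1. Qed.

(* The magnetization moves too slowly to leave a likely set: its stationary
   mean square displacement in [t] steps is at most [4 t]. *)
Lemma slow_magnetization t (a : R) : 0 < a ->
  128 * t%:R <= a ^+ 2 * mean (mag_ge a) -> 0 < mean (mag_ge a) ->
  7 / 8 <= iter t step (mag_ge (a / 2)) (allplus n).
Proof.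
move=> a_gt0 ta p_gt0; set p := mean _ in ta p_gt0.
set f := mag_ge (a / 2); set F := iter t step f (allplus n).
(* One update changes the magnetization by at most 2, hence its square displacement by at most 4. *)
have D : mean (fun s => iter t step (fun y => (mag s - mag y) ^+ 2) s)
    <= t%:R * 4.
  apply: mean_sqr_diff_le => // v s.
  rewrite -[leRHS](upd_cst R n e J v 4 s).
  have key b : (mag s - mag (setspin s v b)) ^+ 2 <= 4.
    have -> : mag s - mag (setspin s v b) = spin R (s v) - spin R b.
      rewrite /mag -sumrB (bigD1 v) //= ffunE eqxx big1 ?addr0 // => w wv.
      by rewrite ffunE (negPf wv) subrr.
    by rewrite /spin; case: (s v); case: b; lra.
  rewrite /upd ler_pM2r ?invr_gt0 ?updD_gt0 //.
  by rewrite lerD // ler_wpM2l ?ising_ge0.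
(* Chebyshev from [s]: falling from [a] or more to below [a / 2] costs a square displacement of at
   least a^2/4. Monotonicity replaces the start [s] by all plus. *)
have G s : mag_ge a s * (1 - F) <=
    4 / a ^+ 2 * iter t step (fun y => (mag s - mag y) ^+ 2) s.
  have Fs : iter t step f s <= F.
    by apply: iter_step_increasing (cle_allplus s); exact: mag_ge_increasing.
  rewrite -iter_stepZ /mag_ge; case: (leP a (mag s)) => as_ /=; last first.
    rewrite mul0r -(iter_step_cst R n e J n_gt0 t 0 s).
    apply: ler_iter_step => y.
    by rewrite mulr_ge0 ?sqr_ge0 // divr_ge0 // sqr_ge0.
  rewrite mul1r; apply: (@le_trans _ _ (1 - iter t step f s)); first lra.
  rewrite -{1}(iter_step_cst R n e J n_gt0 t 1 s) -mulN1r.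
  rewrite -iter_stepZ -iter_stepD.
  apply: ler_iter_step => y; rewrite /f /mag_ge.
  case: (leP (a / 2) (mag y)) => ay /=.
    by rewrite mulN1r subrr mulr_ge0 ?sqr_ge0 // divr_ge0 // sqr_ge0.
  rewrite mulr0 addr0 mulrAC ler_pdivlMr ?exprn_gt0 // mul1r; nra.
have := ler_mean R n e J _ _ G; rewrite meanZ.
have -> : mean (fun s => mag_ge a s * (1 - F)) = (1 - F) * p.
  by rewrite -meanZ; apply: eq_mean => s; rewrite mulrC.
(* The bound is 16 t / a^2, and 128 = 16 * 8. *)
move=> H; have {}H : (1 - F) * p <= p / 8.
  apply: le_trans H _; rewrite mulrAC ler_pdivrMr ?exprn_gt0 //; lra.
rewrite mulrC ler_pM2l // in H; lra.
Qed.

(** For positive [a] the event and its spin flip are disjoint and equally likely. *)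
Lemma mean_mag_ge_half a : 0 < a -> mean (mag_ge a) <= 1 / 2.
Proof.
move=> a0; have : mean (fun s => mag_ge a s + mag_ge a (neg s)) <= 1.
  rewrite -[leRHS](mean_cst R n e J); apply: ler_mean => s.
  rewrite /mag_ge mag_neg.
  by case: (leP a (mag s)) => h1; case: (leP a (- mag s)) => h2 /=; lra.
rewrite meanD mean_neg; lra.
Qed.

Lemma unvisited_minus t (a : R) : 2 * a <= n%:R ->
  let c : R := n%:R / 4 * ((n - 1)%:R / n%:R) ^+ t in
  64 <= c -> 2 * a <= c -> mean (mag_ge a) <= 1 / 16 ->
  225 / 256 <= iter t step (mag_ge a) (allplus n).
Proof.
move=> an c c64 ac p16.
apply: le_trans (iter_step_allplus_ge t _ (mag_ge_increasing a)).
apply: (@le_trans _ _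
    (mean (fun y => 15 / 16 + - (15 / 16) * mag_ge a (neg y)))).
  by rewrite meanD mean_cst meanZ (mean_neg (mag_ge a)); lra.
apply: ler_mean => y; rewrite {1}/mag_ge mag_neg.
case: (leP a (- mag y)) => ay /=.
  rewrite mulr1 subrr -(avg_cst R n n_gt0 t 0); apply: ler_avg => w.
  by case/andP: (mag_ge01 a (pin (fun v => v \notin w) y)).
rewrite mulr0 addr0.
set rho : R := _ ^+ t in c c64 ac.
have rho0 : 0 <= rho by rewrite exprn_ge0 // divr_ge0.
(* If the magnetization is already at least [a], pinning only raises it. *)
have [ya|ya] := leP a (mag y).
  rewrite (eq_avg _ _ _ _ (fun=> 1)) ?avg_cst //; first lra.
  move=> w; rewrite /mag_ge mag_pin.
  suff -> : a <= mag y + 2 * \sum_(v in minus y) (v \notin w)%:R by [].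
  by rewrite (le_trans ya) // lerDl mulr_ge0 // sumr_ge0.
have m4 : n%:R / 4 <= #|minus y|%:R :> R by have := magE y; lra.
pose d := #|minus y|%:R * rho.
have cd : c <= d by rewrite /d ler_wpM2r.
have d0 : 0 < d by lra.
apply: (@le_trans _ _ (1 - 4 / d)).
  have : 4 / d <= 1 / 16 by rewrite ler_pdivrMr //; lra.
  lra.
apply: le_trans (avg_unvisited_ge R n n_gt0 t (minus y) d erefl d0) _.
apply: ler_avg => w; rewrite /mag_ge mag_pin ler_nat.
(* Each unvisited minus vertex lifts the magnetization by 2, so [d / 2] of them lift it by
   [d >= 2 * a], from above [- a] to above [a]. *)
case: (leP (d / 2)) => //= h.
by rewrite lt0b; lra.
Qed.

(** Dichotomy on the likelihood of magnetization at least [a]. The gaps 7/8 - 1/2 and 225/256 - 1/16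
    both exceed 1/4; 2048 = 128 * 16 yields the bound 1/16 in the second case. *)
Lemma not_mixed t (a : R) : 0 < a -> 2 * a <= n%:R ->
  let c : R := n%:R / 4 * ((n - 1)%:R / n%:R) ^+ t in
  64 <= c -> 2 * a <= c -> 2048 * t%:R <= a ^+ 2 ->
  4^-1 < dist_at e J (allplus n) t.
Proof.
move=> a0 an c c64 ac ta.
have a2 : 0 < a ^+ 2 by rewrite exprn_gt0.
have [pt|pt] := leP (128 * t%:R) (a ^+ 2 * mean (mag_ge a)).
  have p0 : 0 < mean (mag_ge a).
    rewrite /mean (bigD1 (allplus n)) //=; apply: ltr_pwDl.
      rewrite /mag_ge mag_allplus (_ : a <= n%:R) ?mulr1 ?ising_gt0 //; lra.
    apply: sumr_ge0 => s _; apply: mulr_ge0; first exact: ising_ge0.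
    by case/andP: (mag_ge01 a s).
  have h := slow_magnetization t a a0 pt p0.
  have a20 : 0 < a / 2 by lra.
  have := mean_mag_ge_half (a / 2) a20.
  have := tv_ge t (allplus n) _ (mag_ge01 (a / 2)); lra.
have p16 : mean (mag_ge a) <= 1 / 16.
  rewrite -(ler_pM2l a2); lra.
have := unvisited_minus t a an c64 ac p16.
have := tv_ge t (allplus n) _ (mag_ge01 a); lra.
Qed.

End Ferromagnet.

(** * Choice of the magnetization threshold for large [n] *)

Section Asymptotics.
Context (R : realType).

(** Uses n/(n-1) = 1 + 1/(n-1) <= exp(1/(n-1)); for n >= 4 this ratio is at most 4/3, which turns
    1/4 into 1/3. *)
Lemma survival_ge (n t : nat) : (4 <= n)%N ->
  t%:R <= 4^-1 * (n%:R * ln n%:R) :> R ->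
  expR (- (ln n%:R / 3)) <= ((n - 1)%:R / n%:R) ^+ t :> R.
Proof.
move=> n4 tn; set L := ln _ in tn *.
have n4R : 4 <= n%:R :> R by rewrite ler_nat.
have L0 : 0 <= L by rewrite ln_ge0 //; lra.
rewrite natrB; last exact: leq_trans n4.
move: tn n4R; set N : R := n%:R => tn N4.
pose x := (N - 1)^-1; have x0 : 0 < x by rewrite invr_gt0; lra.
have tx : t%:R * x <= L / 3 by rewrite ler_pdivrMr; nra.
apply: (@le_trans _ _ (expR (t%:R * - x))); first by rewrite ler_expR; lra.
rewrite expRM_natl; apply: lerXn2r; rewrite ?nnegrE ?expR_ge0 //.
  by rewrite divr_ge0; lra.
rewrite expRN -[leRHS]invrK lef_pV2 ?posrE ?expR_gt0 //; last first.
  by rewrite invr_gt0 divr_gt0; lra.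
apply: le_trans (expR_ge1Dx x).
rewrite invf_div le_eqVlt; apply/orP; left; apply/eqP; rewrite /x; field; lra.
Qed.

(** With s = n^(1/6) and a = s^4/8, [c] is at least s^4/4 = 2a, while ln n <= 6s makes [t] of order
    at most s^7, below a^2 = s^8/64. *)
Lemma exists_threshold : exists N : nat, forall n t : nat, (N <= n)%N ->
  t%:R <= 4^-1 * (n%:R * ln n%:R) :> R ->
  exists a : R, let c : R := n%:R / 4 * ((n - 1)%:R / n%:R) ^+ t in
  [/\ 0 < a, 2 * a <= n%:R, 64 <= c, 2 * a <= c & 2048 * t%:R <= a ^+ 2].
Proof.
(* The last inequality needs s >= 3072 * 64, which is below 64^3. *)
pose K : R := 64 * 64 * 64.
exists (maxn 4 (Num.bound (K ^+ 6))) => n t; rewrite geq_max => /andP[n4 nK] tn.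
have n0 : 0 < n%:R :> R by rewrite ltr0n; exact: leq_trans n4.
have rho := survival_ge n t n4 tn.
set L := ln _ in tn rho; pose s := expR (L / 6).
have s6 : n%:R = s ^+ 6.
  by rewrite -expRM_natl mulrC divfK ?pnatr_eq0 // lnK.
have Ks : K <= s.
  rewrite -(@ler_pXn2r _ 6) ?nnegrE ?expR_ge0 //; last by rewrite /K; lra.
  rewrite -s6 (le_trans (ltW (archi_boundP _))) ?ler_nat //.
  by rewrite exprn_ge0 // /K; lra.
have s0 : 0 < s by exact: expR_gt0.
have Ls : L <= 6 * s by have := expR_ge1Dx (L / 6); rewrite -/s; lra.
have rhoE : expR (- (L / 3)) = (s ^+ 2)^-1.
  by rewrite expRN -expRM_natl; congr (expR _)^-1; lra.
rewrite /K in Ks; exists (s ^+ 4 / 8) => c.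
have s4 : 0 < s ^+ 4 by rewrite exprn_gt0.
have cs : s ^+ 4 / 4 <= c.
  apply: le_trans (_ : n%:R / 4 * (s ^+ 2)^-1 <= _).
    by rewrite s6 le_eqVlt; apply/orP; left; apply/eqP; field; rewrite gt_eqF.
  by rewrite /c ler_wpM2l -?rhoE // divr_ge0.
have s256 : 256 <= s ^+ 4.
  have s16 : 16 <= s ^+ 2 by rewrite expr2; nra.
  by rewrite (exprM s 2 2) expr2; nra.
split; first by rewrite divr_gt0.
- have : 1 <= s ^+ 2 by rewrite expr2; nra.
  by rewrite s6 (exprD s 4 2); nra.
- lra.
- lra.
have tL : 2048 * t%:R <= 3072 * s ^+ 7.
  rewrite (exprSr s 6) -s6; nra.
apply: le_trans tL _.
rewrite (_ : (s ^+ 4 / 8) ^+ 2 = s ^+ 7 * (s / 64)); last by field.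
rewrite mulrC ler_pM2l ?exprn_gt0 //; lra.
Qed.

End Asymptotics.

Theorem theorem1 (R : realType) :
  exists eps : nat -> R, eps n @[n --> \oo] --> 0 /\
  forall (n : nat) (e : rel 'I_n) (J : 'I_n -> 'I_n -> R),
    symmetric e -> irreflexive e -> (forall i j, 0 <= J i j) ->
    forall t : nat, is_tmix e J (allplus n) t ->
      (4^-1 - eps n) * (n%:R * ln (n%:R : R)) <= t%:R.
Proof.
have [N0 hN] := exists_threshold R.
pose N := maxn 1 N0.
(* The error vanishes beyond the threshold; below it, 1/4 makes the bound trivial. *)
exists (fun n => if (N <= n)%N then 0 else 4^-1); split.
  apply: cvg_near_cst; exists N => // n /= Nn.
  by rewrite Nn.
move=> n e J _ _ J0 t [mixed _]; case: ifP => [|_]; last by rewrite subrr mul0r.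
rewrite geq_max subr0 => /andP[n0 Nn].
rewrite leNgt; apply/negP => /ltW tn.
have [a [a0 an c64 ac ta]] := hN n t Nn tn.
by have := not_mixed R n e J n0 J0 t a a0 an c64 ac ta; rewrite ltNge mixed.
Qed.
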